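(* Let $g:\mathbb{R}\times\mathbb{R}\to\mathbb{R}$ be given by $g(x,\sigma)=\frac12x^2\phi(\sigma)$ and let $\sigma_T:\mathscr{P}_2(\mathbb{R})\to\mathbb{R}$ be $\sigma_T(m)=\frac12\int_{\mathbb{R}}x^2\,dm(x)$, where $\phi:\mathbb{R}\to\mathbb{R}$ is a smooth, non-negative function satisfying $$\phi(\sigma)\ge-2\sigma\phi'(\sigma)\qquad\text{for all }\sigma .$$ Then $G:\mathbb{R}\times\mathscr{P}_2(\mathbb{R})\to\mathbb{R}$ given by $G(x,m)=g(x,\sigma_T(m))$ satisfies the displacement monotonicity condition (D). However, in general $G$ does not satisfy $\pm(\mathrm{L}^2)$ or $\pm(\sigma)$: there exists such a $\phi$ for which $G$ satisfies none of $(\mathrm{L}^2)$, $-(\mathrm{L}^2)$, $(\sigma)$, $-(\sigma)$.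
   Context: $\mathscr{P}_2(\mathbb{R})$: Borel probability measures on $\mathbb{R}$ with finite second moment. $(\Omega,\mathcal{A},\mathbb{P})$ is an atomless probability space, $\mathbb{H}=L^2(\Omega;\mathbb{R})$, $\mathcal{L}_X$ the law of $X\in\mathbb{H}$. (D): $\mathbb{E}[(D_xG(X_1,\mathcal{L}_{X_1})-D_xG(X_2,\mathcal{L}_{X_2}))(X_1-X_2)]\ge0$ for all $X_1,X_2\in\mathbb{H}$. The Lagrangian is $L(x,v)=\frac12|v|^2$, and optimality of endpoints is expressed by the first-order condition $y+T\,D_xG(y,m)=x$. For $X_0\in\mathbb{H}$ and $T>0$, put (here these are single-valued since $x\mapsto g(x,\sigma)$ is convex) $$\tilde E_T(X)=(I+T\,D_xG(\cdot,\mathcal{L}_X))^{-1}(X_0),\qquad \Omega(\sigma)=\sigma_T\big(\mathcal{L}_{(I+T\,D_xg(\cdot,\sigma))^{-1}(X_0)}\big).$$ Condition $(\mathrm{L}^2)$: for all $X_0\in\mathbb{H}$ and all $T>0$, $\mathbb{E}[(\tilde E_T(X_1)-\tilde E_T(X_2))(X_1-X_2)]\le\mathbb{E}|X_1-X_2|^2$ for all $X_1,X_2\in\mathbb{H}$. Condition $(\sigma)$: for all $X_0\in\mathbb{H}$ and all $T>0$, $(\Omega(\sigma_1)-\Omega(\sigma_2))(\sigma_1-\sigma_2)\le|\sigma_1-\sigma_2|^2$ for all $\sigma_1,\sigma_2\in\mathrm{range}\,\sigma_T$. Conditions $-(\mathrm{L}^2)$ and $-(\sigma)$ are the same with the inequality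 sign reversed ($\ge$ in place of $\le$). *)

(* Defs.v *)
From HB Require Import structures.
From mathcomp Require Import all_boot all_order all_algebra.
From mathcomp Require Import all_classical all_reals all_analysis.
From mathcomp Require Import measurable_realfun.
Set Implicit Arguments.
Unset Strict Implicit.
Unset Printing Implicit Defensive.
Import Order.TTheory GRing.Theory Num.Theory.
Import numFieldNormedType.Exports.
Local Open Scope classical_set_scope.
Local Open Scope ring_scope.

Definition atomless d (T : measurableType d) (R : realType)
    (mu : {measure set T -> \bar R}) :=
  forall A, measurable A -> (0 < mu A)%E ->
    exists B, [/\ measurable B, B `<=` A, (0 < mu B)%E & (mu B < mu A)%E].

Definition smooth (R : realType) (f : R -> R) :=
  forall (n : nat) (x : R), derivable (derive1n n f) x 1.

Record P2 (R : realType) := MkP2 {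
  P2_measure :> probability R R ;
  P2_second_moment : (\int[P2_measure]_x (x ^+ 2)%:E < +oo)%E }.

Lemma le1_2E (R : realType) : (1 <= 2%:E :> \bar R)%E.
Proof. by rewrite lee_fin ler1n. Qed.

(* Square-integrable random variables are not quotiented by almost sure
   equality: everything below depends on them only through laws and
   expectations. *)
Definition L2 d (T : measurableType d) (R : realType) (P : probability T R) :=
  LfunType P (le1_2E R).

Lemma law_second_moment d (T : measurableType d) (R : realType)
    (P : probability T R) (X : L2 P) :
  (\int[distribution P X]_x (x ^+ 2)%:E < +oo)%E.
Proof.
rewrite ge0_integral_distribution; last 2 first.
- by apply/measurable_EFinP; exact: measurable_funX.
- by move=> y; rewrite lee_fin sqr_ge0.
have /Lfun2_integrable_sqr/integrableP[_] := LfunP X.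
by under eq_integral => x _ do rewrite /= ger0_norm ?sqr_ge0//.
Qed.

Definition law d (T : measurableType d) (R : realType) (P : probability T R)
    (X : L2 P) : P2 R :=
  MkP2 (law_second_moment X).

(* The derivative in the first (space) variable. *)
Definition Dx (R : realType) (M : Type) (G : R -> M -> R) (x : R) (m : M) : R :=
  derive1 (fun y => G y m) x.

(* (I + t f)^{-1}(X0) as an element of L2.  [pinv] is the inverse function of
   y |-> y + t f(y), and [insubd 0] bundles the composition with X0 into L2.
   Both are total, with junk values if the map is not bijective or the
   composition is not square-integrable; neither occurs when f is the
   derivative of a differentiable convex function and t > 0. *)
Definition resolvent d (T : measurableType d) (R : realType)
    (P : probability T R) (t : R) (f : R -> R) (X0 : L2 P) : L2 P :=
  insubd (0 : L2 P) (pinv setT (fun y => y + t * f y) \o X0).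

Section conditions.
Context d (T : measurableType d) (R : realType) (P : probability T R).
Implicit Types (G : R -> P2 R -> R) (g : R -> R -> R) (sigmaT : P2 R -> R).

Definition displacement_monotone G :=
  forall X1 X2 : L2 P,
    (0 <= 'E_P[fun w => ((Dx G (X1 w) (law X1) - Dx G (X2 w) (law X2))
                         * (X1 w - X2 w))%R])%E.

Definition E_tilde G (X0 : L2 P) (t : R) (X : L2 P) : L2 P :=
  resolvent t (fun y => Dx G y (law X)) X0.

Definition Omega g sigmaT (X0 : L2 P) (t sigma : R) : R :=
  sigmaT (law (resolvent t (fun y => Dx g y sigma) X0)).

Definition cond_L2 G :=
  forall (X0 : L2 P) (t : R), 0 < t -> forall X1 X2 : L2 P,
    ('E_P[fun w => ((E_tilde G X0 t X1 w - E_tilde G X0 t X2 w)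
                    * (X1 w - X2 w))%R]
     <= 'E_P[fun w => (`|X1 w - X2 w| ^+ 2)%R])%E.

Definition cond_L2_rev G :=
  forall (X0 : L2 P) (t : R), 0 < t -> forall X1 X2 : L2 P,
    ('E_P[fun w => ((E_tilde G X0 t X1 w - E_tilde G X0 t X2 w)
                    * (X1 w - X2 w))%R]
     >= 'E_P[fun w => (`|X1 w - X2 w| ^+ 2)%R])%E.

Definition cond_sigma g sigmaT :=
  forall (X0 : L2 P) (t : R), 0 < t ->
  forall s1 s2 : R, range sigmaT s1 -> range sigmaT s2 ->
    (Omega g sigmaT X0 t s1 - Omega g sigmaT X0 t s2) * (s1 - s2)
    <= `|s1 - s2| ^+ 2.

Definition cond_sigma_rev g sigmaT :=
  forall (X0 : L2 P) (t : R), 0 < t ->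
  forall s1 s2 : R, range sigmaT s1 -> range sigmaT s2 ->
    (Omega g sigmaT X0 t s1 - Omega g sigmaT X0 t s2) * (s1 - s2)
    >= `|s1 - s2| ^+ 2.

End conditions.

Definition sigma_T (R : realType) (m : P2 R) : R := 2^-1 * \int[m]_x (x ^+ 2).

Definition g_phi (R : realType) (phi : R -> R) (x sigma : R) : R :=
  2^-1 * x ^+ 2 * phi sigma.

Definition G_phi (R : realType) (phi : R -> R) (x : R) (m : P2 R) : R :=
  g_phi phi x (sigma_T m).

Definition admissible (R : realType) (phi : R -> R) :=
  [/\ smooth phi, forall s, 0 <= phi s
    & forall s, phi s >= - 2 * s * derive1 phi s].

(* Main.v *)
Require Import Defs.
From HB Require Import structures.
From mathcomp Require Import all_boot all_order all_algebra.
From mathcomp Require Import all_classical all_reals all_analysis.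
From mathcomp Require Import measurable_realfun ring lra.
Set Implicit Arguments.
Unset Strict Implicit.
Unset Printing Implicit Defensive.
Import Order.TTheory GRing.Theory Num.Theory.
Import numFieldNormedType.Exports.
Local Open Scope classical_set_scope.
Local Open Scope ring_scope.

(** For this [G], [D_x G(x, m) = x phi(sigma_T m)]: both the monotonicity
condition and the optimality condition are linear in the space variable.

Displacement monotonicity.  Write [a], [b] for the L2 norms of [X1], [X2], so
that [sigma_T] takes the values [a^2/2] and [b^2/2] at their laws, and let
[u], [v] be the values of [phi] there.  The expectation in (D) is
[u a^2 + v b^2 - (u + v) E(X1 X2)].  Since [u + v >= 0], Cauchy-Schwarz
([inner_cauchy_schwarz]) bounds it below by
[u a^2 + v b^2 - (u + v) a b = (a u - b v) (a - b)].  This is nonnegative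
because [y |-> y phi(y^2/2)] is nondecreasing on the half-line [y >= 0]
([admissible_homo]): with [s = y^2/2] its derivative is
[phi(s) + 2 s phi'(s)], and the structural inequality on [phi] says precisely
that this is nonnegative.

Failure of the other conditions.  The resolvent is division by
[1 + T phi(sigma)] ([resolvent_linear]), hence [E_tilde] and [Omega] are
homogeneous in [X0], of degree one and two, whereas the other sides of the
four inequalities do not depend on [X0].  Taking [X0 = 0] refutes both
reversed conditions.  Taking [X0] to be a large constant refutes (L2) as soon
as [phi] is not constant on the half-line, since [X0] may have either
sign ([not_cond_L2]), and refutes (sigma) as soon as [phi] decreases
somewhere on it ([not_cond_sigma]), since [Omega] then increases.  A single
function that is admissible and decreasing is [phi(s) = 2 + exp(-s)]. *)

(** * Second moments of square-integrable random variables *)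

Section L2_moments.
Context d (T : measurableType d) (R : realType) (P : probability T R).
Implicit Types X Y : L2 P.

Definition inner X Y : R := \int[P]_w (X w * Y w).

Lemma integrable_mul X Y :
  P.-integrable [set: T] (EFin \o (fun w => X w * Y w)).
Proof. exact/Lfun1_integrable/Lfun2_mul_Lfun1/LfunP/LfunP. Qed.

Lemma integrable_scale_mul a X Y :
  P.-integrable [set: T] (EFin \o (fun w => a * (X w * Y w))).
Proof. exact: (integrableZl measurableT a (integrable_mul X Y)). Qed.

Lemma expectation_quadratic (a b c : R) X Y :
  ('E_P[fun w => (a * (X w * X w) + b * (Y w * Y w) + c * (X w * Y w))%R]
   = (a * inner X X + b * inner Y Y + c * inner X Y)%:E)%E.
Proof.
have iX := integrable_scale_mul a X X.
have iY := integrable_scale_mul b Y Y.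
have iXY := integrable_scale_mul c X Y.
have iS := integrableD measurableT iX iY.
have iE := integrableD measurableT iS iXY.
rewrite unlock -[LHS]fineK; last exact: (integrable_fin_num measurableT iE).
congr EFin; rewrite -/(Rintegral _ _ _) RintegralD// RintegralD//.
by rewrite !RintegralZl//; exact: integrable_mul.
Qed.

Lemma inner_quadratic_ge0 (a b : R) X Y :
  0 <= a ^+ 2 * inner X X + b ^+ 2 * inner Y Y - 2 * a * b * inner X Y.
Proof.
rewrite -mulNr -lee_fin -expectation_quadratic unlock integral_ge0// => w _.
rewrite lee_fin [leRHS](_ : _ = (a * X w - b * Y w) ^+ 2) ?sqr_ge0//; ring.
Qed.

Lemma inner_ge0 X : 0 <= inner X X.
Proof. by have := inner_quadratic_ge0 1 0 X X; lra. Qed.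

(** The quadratic form of [inner_quadratic_ge0], evaluated at the two norms,
gives the bound after division by their product.  If one norm vanishes the
form is affine in one coefficient, which forces the mixed moment to be
nonpositive. *)
Lemma inner_cauchy_schwarz X Y :
  inner X Y <= Num.sqrt (inner X X) * Num.sqrt (inner Y Y).
Proof.
have degenerate (U V : L2 P) : inner U U = 0 -> inner U V <= 0.
  move=> U0; rewrite leNgt; apply/negP => UV0.
  (* This coefficient makes the form equal to -1. *)
  have := inner_quadratic_ge0 ((inner V V + 1) / (2 * inner U V)) 1 U V.
  rewrite U0 mulr0 expr1n mulr1 add0r mul1r.
  have -> : 2 * ((inner V V + 1) / (2 * inner U V)) * inner U V
    = inner V V + 1 by field; rewrite gt_eqF.
  lra.
have [X0|X0] := eqVneq (inner X X) 0.
  by rewrite X0 sqrtr0 mul0r degenerate.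
have [Y0|Y0] := eqVneq (inner Y Y) 0.
  rewrite Y0 sqrtr0 mulr0 [leLHS](_ : _ = inner Y X) ?degenerate//.
  by apply: eq_Rintegral => w _; rewrite mulrC.
have a0 : 0 < Num.sqrt (inner X X) by rewrite sqrtr_gt0 lt0r X0 inner_ge0.
have b0 : 0 < Num.sqrt (inner Y Y) by rewrite sqrtr_gt0 lt0r Y0 inner_ge0.
have := inner_quadratic_ge0 (Num.sqrt (inner Y Y)) (Num.sqrt (inner X X)) X Y.
have := sqr_sqrtr (inner_ge0 X); have := sqr_sqrtr (inner_ge0 Y).
move: a0 b0; move: (Num.sqrt (inner X X)) (Num.sqrt (inner Y Y)) => a b a0 b0.
move=> <- <- h; rewrite -subr_ge0 -(pmulr_rge0 _ (mulr_gt0 a0 b0)); nra.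
Qed.

(** * The map sigma_T and the resolvent of a linear map *)

Lemma sigma_T_law X : sigma_T (law X) = 2^-1 * inner X X.
Proof.
rewrite /sigma_T /Rintegral ge0_integral_distribution//; last 2 first.
- by apply/measurable_EFinP; exact: measurable_funX.
- by move=> y; rewrite lee_fin sqr_ge0.
Qed.

Definition L2_cst (c : R) : L2 P := Lfun_Sub (le1_2E R) (Lfun_cst P c 2).

Lemma sigma_T_law_cst c : sigma_T (law (L2_cst c)) = 2^-1 * c ^+ 2.
Proof.
rewrite sigma_T_law /inner /Rintegral/= integral_cst//.
by rewrite [X in (_ * X)%E](probability_setT P) mule1 -expr2.
Qed.

Lemma range_sigma_T s : 0 <= s -> range (@sigma_T R) s.
Proof.
move=> s0; exists (law (L2_cst (Num.sqrt (2 * s)))) => //.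
by rewrite sigma_T_law_cst sqr_sqrtr ?mulr_ge0// mulrA mulVf ?mul1r.
Qed.

(** [y |-> y + t f y] is then multiplication by a nonzero constant, so neither
of the two junk values in the definition of [resolvent] occurs: the map is
injective with range the whole line, and the composition with [X0] is a scalar
multiple of [X0]. *)
Lemma resolvent_linear (t k : R) (f : R -> R) (X0 : L2 P) (w : T) :
  1 + t * k != 0 -> (forall y, f y = y * k) ->
  resolvent t f X0 w = X0 w / (1 + t * k).
Proof.
move=> tk0 fE; set F := fun y => y + t * f y.
have FE y : F y = y * (1 + t * k) by rewrite /F fE; ring.
have injF : {in [set: R] &, injective F}.
  by move=> x y _ _; rewrite !FE => /(mulIf tk0).
have pinvE x : pinv setT F x = x / (1 + t * k).
  have {1}-> : x = F (x / (1 + t * k)) by rewrite FE divfK.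
  by rewrite pinvKV// in_setT.
rewrite /resolvent insubdK/= ?pinvE//.
have -> : pinv setT F \o X0 = (1 + t * k)^-1 \o* (X0 : T -> R).
  by apply/funext => x /=; rewrite pinvE mulrC.
by apply: Lfun_scale; [rewrite ler1n|exact: LfunP].
Qed.

End L2_moments.

(** * The derivative of G and displacement monotonicity *)

Section phi.
Context (R : realType) (phi : R -> R).

Lemma Dx_g_phi x s : Dx (g_phi phi) x s = x * phi s.
Proof.
rewrite /Dx /g_phi derive1E.
have h : is_derive x (1:R) (fun y : R => 2^-1 * y ^+ 2 * phi s) (x * phi s).
  apply: is_derive_eq.
  by rewrite /GRing.scale/=; field.
by rewrite derive_val.
Qed.

Lemma Dx_G_phi x m : Dx (G_phi phi) x m = x * phi (sigma_T m).
Proof. exact: Dx_g_phi. Qed.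

(** The condition on [phi] is the nonnegativity of the derivative of
[y |-> y phi(y^2/2)], read at [s = y^2/2]. *)
Lemma admissible_homo a b : admissible phi -> 0 <= a -> a <= b ->
  a * phi (2^-1 * a ^+ 2) <= b * phi (2^-1 * b ^+ 2).
Proof.
move=> [sphi phi0 dphi].
pose h (y : R) := y * phi (2^-1 * y ^+ 2).
pose h' (y : R) := phi (2^-1 * y ^+ 2) + y ^+ 2 * derive1 phi (2^-1 * y ^+ 2).
have dh y : is_derive y (1:R) h (h' y).
  have dphiy : is_derive (2^-1 * y ^+ 2) (1:R) phi (derive1 phi (2^-1 * y ^+ 2)).
    by rewrite derive1E; apply/derivableP; exact: (sphi 0%N).
  have d2 : is_derive y (1:R) (fun z : R => 2^-1 * z ^+ 2) y.
    by apply: is_derive_eq; rewrite /GRing.scale/=; field.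
  have d3 := @is_derive1_comp _ phi (fun z : R => 2^-1 * z ^+ 2) y _ _ dphiy d2.
  apply: is_derive_eq.
  by rewrite /h' /GRing.scale/=; ring.
move=> a0 ab.
apply: (@ger0_derive1_le_cc R h a b) => //.
- move=> x _; rewrite derive1E derive_val /h'.
  by have := dphi (2^-1 * x ^+ 2); lra.
- by apply: derivable_within_continuous => x _.
- by rewrite in_itv/= lexx ab.
- by rewrite in_itv/= lexx ab.
Qed.

End phi.

Section conds.
Context d (T : measurableType d) (R : realType) (P : probability T R).
Implicit Types phi : R -> R.

Lemma admissible_displacement_monotone phi :
  admissible phi -> displacement_monotone P (G_phi phi).
Proof.
move=> phiA X1 X2; have [_ phi_ge0 _] := phiA.
set s1 := sigma_T (law X1); set s2 := sigma_T (law X2).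
have -> : (fun w => (Dx (G_phi phi) (X1 w) (law X1)
                     - Dx (G_phi phi) (X2 w) (law X2)) * (X1 w - X2 w))
  = (fun w => phi s1 * (X1 w * X1 w) + phi s2 * (X2 w * X2 w)
              + - (phi s1 + phi s2) * (X1 w * X2 w)).
  by apply/funext => w; rewrite !Dx_G_phi -/s1 -/s2; ring.
rewrite expectation_quadratic lee_fin.
have := inner_cauchy_schwarz X1 X2.
have s1E : s1 = 2^-1 * Num.sqrt (inner X1 X1) ^+ 2.
  by rewrite /s1 sigma_T_law sqr_sqrtr ?inner_ge0.
have s2E : s2 = 2^-1 * Num.sqrt (inner X2 X2) ^+ 2.
  by rewrite /s2 sigma_T_law sqr_sqrtr ?inner_ge0.
have := sqr_sqrtr (inner_ge0 X1); have := sqr_sqrtr (inner_ge0 X2).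
have := sqrtr_ge0 (inner X1 X1); have := sqrtr_ge0 (inner X2 X2).
have := phi_ge0 s1; have := phi_ge0 s2.
rewrite s1E s2E; move: (Num.sqrt _) (Num.sqrt _) (inner X1 X2) => a b C.
set u := phi (2^-1 * a ^+ 2); set v := phi (2^-1 * b ^+ 2).
move=> v0 u0 b0 a0 <- <- CS.
(* The sum of the next two facts is the claim: it remains to expand. *)
have hab : 0 <= (a * u - b * v) * (a - b).
  have [ab|ba] := leP a b.
    by have := admissible_homo phiA a0 ab; rewrite -/u -/v => ?; nra.
  by have := admissible_homo phiA b0 (ltW ba); rewrite -/u -/v => ?; nra.
have : (u + v) * C <= (u + v) * (a * b) by rewrite ler_wpM2l ?addr_ge0.
nra.
Qed.

(** * The maps E_tilde and Omega at constant random variables *)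

Lemma E_tilde_phi phi X0 t (X : L2 P) w : (forall s, 0 <= phi s) -> 0 < t ->
  E_tilde (G_phi phi) X0 t X w = X0 w / (1 + t * phi (sigma_T (law X))).
Proof.
move=> phi0 t0; apply: resolvent_linear => [|y]; last exact: Dx_G_phi.
by rewrite gt_eqF// ltr_pwDl// mulr_ge0// ltW.
Qed.

Lemma expectation_E_tilde_cst phi t k a b : (forall s, 0 <= phi s) -> 0 < t ->
  ('E_P[fun w => ((E_tilde (G_phi phi) (L2_cst P k) t (L2_cst P a) w
                   - E_tilde (G_phi phi) (L2_cst P k) t (L2_cst P b) w)
                  * (L2_cst P a w - L2_cst P b w))%R]
   = ((k / (1 + t * phi (2^-1 * a ^+ 2)) - k / (1 + t * phi (2^-1 * b ^+ 2)))
      * (a - b))%:E)%E.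
Proof.
move=> phi0 t0; rewrite -[RHS](expectation_cst P); congr expectation.
apply/funext => w; rewrite -!(sigma_T_law_cst P).
by congr ((_ - _) * _); exact: E_tilde_phi.
Qed.

Lemma expectation_dist_cst a b :
  ('E_P[fun w => (`|L2_cst P a w - L2_cst P b w| ^+ 2)%R]
   = ((a - b) ^+ 2)%:E)%E.
Proof. by rewrite -real_normK ?num_real// -[RHS](expectation_cst P). Qed.

Lemma Omega_phi_cst phi (c t s : R) : (forall s, 0 <= phi s) -> 0 < t ->
  Omega (g_phi phi) (@sigma_T R) (L2_cst P c) t s
  = 2^-1 * (c / (1 + t * phi s)) ^+ 2.
Proof.
move=> phi0 t0; rewrite /Omega -(sigma_T_law_cst P); congr (sigma_T (law _)).
apply/LfuneqP => w; rewrite (@resolvent_linear _ _ _ _ _ (phi s))//.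
- by rewrite gt_eqF// ltr_pwDl// mulr_ge0// ltW.
- by move=> y; exact: Dx_g_phi.
Qed.

(** * Failure of the four conditions *)

(** The left-hand side is linear in the constant [X0], with a nonzero slope
since the two values of [phi] differ, while the right-hand side is fixed. *)
Lemma not_cond_L2 phi a b : (forall s, 0 <= phi s) ->
  phi (2^-1 * a ^+ 2) != phi (2^-1 * b ^+ 2) -> ~ cond_L2 P (G_phi phi).
Proof.
move=> phi0 phiab.
have ab0 : a - b != 0 by rewrite subr_eq0; apply: contra_neq phiab => ->.
set c := fun x : R => (1 + 1 * phi (2^-1 * x ^+ 2))^-1.
have cab0 : c a - c b != 0.
  rewrite subr_eq0; apply: contra_neq phiab => /invr_inj/addrI.
  by rewrite !mul1r.
(* The left-hand side at [X0 = K] exceeds the right-hand side by 1. *)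
pose K := ((a - b) ^+ 2 + 1) / ((c a - c b) * (a - b)).
move=> /(_ (L2_cst P K) 1 ltr01 (L2_cst P a) (L2_cst P b)).
rewrite expectation_E_tilde_cst// expectation_dist_cst lee_fin.
rewrite -/(c a) -/(c b) -mulrBr -mulrA divfK ?mulf_neq0//; lra.
Qed.

(** The factor [X0^2] in [Omega] is nonnegative, so the left-hand side can only
be made large where [Omega] increases, that is, where [phi] decreases; in
[not_cond_L2] the sign of [X0] compensates for either direction. *)
Lemma not_cond_sigma phi s1 s2 : (forall s, 0 <= phi s) ->
  0 <= s1 -> s1 < s2 -> phi s2 < phi s1 ->
  ~ cond_sigma P (g_phi phi) (@sigma_T R).
Proof.
move=> phi0 s10 s12 phis.
set c := fun s : R => (1 + 1 * phi s)^-1.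
have c0 s : 0 < c s by rewrite invr_gt0 ltr_pwDl// mul1r.
have c12 : c s1 < c s2.
  by rewrite /c !mul1r ltf_pV2 ?ltrD2l// posrE ltr_pwDl.
have D0 : 0 < (c s2 ^+ 2 - c s1 ^+ 2) * (s2 - s1).
  by rewrite mulr_gt0 ?subr_gt0// ltr_pXn2r// nnegrE ltW.
set N := (s2 - s1) ^+ 2 + 1.
have N0 : 0 < N by rewrite ltr_wpDl// sqr_ge0.
(* Again the constant for which the left-hand side is the right-hand side
   plus 1. *)
pose K := Num.sqrt (2 * (N / ((c s2 ^+ 2 - c s1 ^+ 2) * (s2 - s1)))).
have K2 : K ^+ 2 = 2 * (N / ((c s2 ^+ 2 - c s1 ^+ 2) * (s2 - s1))).
  by rewrite sqr_sqrtr// mulr_ge0// divr_ge0 ?ltW.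
move=> /(_ (L2_cst P K) 1 ltr01 s2 s1).
move=> /(_ (range_sigma_T P (le_trans s10 (ltW s12))) (range_sigma_T P s10)).
rewrite !Omega_phi_cst// -/(c s1) -/(c s2) real_normK ?num_real// leNgt.
move=> /negP; apply.
rewrite [ltRHS](_ : _ = N) ?ltrDl ?ltr01//.
have -> : (2^-1 * (K * c s2) ^+ 2 - 2^-1 * (K * c s1) ^+ 2) * (s2 - s1)
  = 2^-1 * K ^+ 2 * ((c s2 ^+ 2 - c s1 ^+ 2) * (s2 - s1)) by ring.
by rewrite K2 mulKf ?pnatr_eq0// divfK ?gt_eqF.
Qed.

(** With [X0 = 0] the left-hand side vanishes, and the right-hand side is the
squared distance of two distinct constants. *)
Lemma not_cond_L2_rev phi : (forall s, 0 <= phi s) ->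
  ~ cond_L2_rev P (G_phi phi).
Proof.
move=> phi0 /(_ (L2_cst P 0) 1 ltr01 (L2_cst P 1) (L2_cst P 0)).
rewrite expectation_E_tilde_cst// expectation_dist_cst lee_fin; lra.
Qed.

Lemma not_cond_sigma_rev phi : (forall s, 0 <= phi s) ->
  ~ cond_sigma_rev P (g_phi phi) (@sigma_T R).
Proof.
move=> phi0 /(_ (L2_cst P 0) 1 ltr01 1 0).
move=> /(_ (range_sigma_T P ler01) (range_sigma_T P (lexx _))).
rewrite !Omega_phi_cst// !mul0r real_normK ?num_real//; lra.
Qed.

End conds.

(** * An admissible decreasing function *)

Section witness.
Context (R : realType).

Lemma is_derive_scale_expRN (c s : R) :
  is_derive s 1 (fun s : R => c * expR (- s)) (- c * expR (- s)).
Proof. by apply: is_derive_eq; rewrite /GRing.scale/=; ring. Qed.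

Lemma derive1n_scale_expRN (c : R) n :
  derive1n n (fun s : R => c * expR (- s))
  = (fun s => (- 1) ^+ n * c * expR (- s)).
Proof.
elim: n => [|n IH]; first by apply/funext => s; rewrite mul1r.
rewrite derive1nS IH; apply/funext => s; rewrite derive1E.
rewrite (@derive_val _ _ _ _ _ _ _ (is_derive_scale_expRN _ _)) exprS; ring.
Qed.

(** The exponential alone violates the structural inequality for [s > 1/2];
adding a constant only increases the left-hand side of that inequality and
keeps the function decreasing. *)
Definition phi_decr (s : R) : R := 2 + expR (- s).

Lemma is_derive_phi_decr (s : R) : is_derive s 1 phi_decr (- expR (- s)).
Proof. by apply: is_derive_eq; rewrite /GRing.scale/=; ring. Qed.

(** The factor [-1] gives the derivative the shape required by
[derive1n_scale_expRN]. *)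
Lemma derive1_phi_decr : derive1 phi_decr = (fun s => -1 * expR (- s)).
Proof.
apply/funext => s; rewrite derive1E mulN1r.
exact: (@derive_val _ _ _ _ _ _ _ (is_derive_phi_decr s)).
Qed.

Lemma smooth_phi_decr : smooth phi_decr.
Proof.
move=> [|n] s; first exact: (@ex_derive _ _ _ _ _ _ _ (is_derive_phi_decr s)).
rewrite /derive1n iterSr derive1_phi_decr -/(derive1n n _) derive1n_scale_expRN.
exact: (@ex_derive _ _ _ _ _ _ _ (is_derive_scale_expRN _ s)).
Qed.

Lemma phi_decr_ge0 s : 0 <= phi_decr s.
Proof. by rewrite addr_ge0// expR_ge0. Qed.

(** The inequality reads [2 + exp(-s) >= 2 s exp(-s)]: the right-hand side is
nonpositive for [s <= 0], and at most 2 in general because [s <= exp(s)]. *)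
Lemma admissible_phi_decr : admissible phi_decr.
Proof.
split; [exact: smooth_phi_decr|exact: phi_decr_ge0|move=> s].
rewrite derive1_phi_decr /phi_decr.
have e0 := expR_gt0 (- s).
have [s0|s0] := leP s 0; first by nra.
have : s * expR (- s) <= 1.
  rewrite -(expRxMexpNx_1 s) ler_pM2r//.
  by rewrite (le_trans _ (expR_ge1Dx s))// lerDr.
lra.
Qed.

Lemma phi_decr_lt s1 s2 : s1 < s2 -> phi_decr s2 < phi_decr s1.
Proof. by move=> s12; rewrite ltrD2l ltr_expR ltrN2. Qed.

End witness.

Theorem proposition4p3 (R : realType) (d : measure_display)
    (T : measurableType d) (P : probability T R) (hP : atomless P) :
  (forall phi : R -> R, admissible phi -> displacement_monotone P (G_phi phi)) /\
  (exists phi : R -> R,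
    [/\ admissible phi,
        ~ cond_L2 P (G_phi phi),
        ~ cond_L2_rev P (G_phi phi),
        ~ cond_sigma P (g_phi phi) (@sigma_T R) &
        ~ cond_sigma_rev P (g_phi phi) (@sigma_T R)]).
Proof.
split=> [phi|]; first exact: admissible_displacement_monotone.
exists (@phi_decr R); have phi0 := @phi_decr_ge0 R.
split.
- exact: admissible_phi_decr.
- apply: (@not_cond_L2 _ _ _ P _ 1 0) => //.
  by rewrite lt_eqF// phi_decr_lt// expr0n mulr0 expr1n mulr1 invr_gt0.
- exact: not_cond_L2_rev.
- by apply: (@not_cond_sigma _ _ _ P _ 0 1) => //; exact: phi_decr_lt.
- exact: not_cond_sigma_rev.
Qed.
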